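(* For all $q$ and all $m\geq 0$, $$(q-1)q^{m-1}-q^{\lceil\frac{m}{2}\rceil-1}\leq\rho(1,m)\leq (q-1)q^{m-1}-q^{\frac{m}{2}-1}.$$
   Context: Let $q=p^t$ with $p$ a prime number, $\mathbb{F}_q$ the field with $q$ elements, and $m$ an integer. $B_m^q=\mathbb{F}_q[X_1,\ldots,X_m]/(X_1^q-X_1,\ldots,X_m^q-X_m)$ is identified with the set of all functions $\mathbb{F}_q^m\to\mathbb{F}_q$. The degree $\deg(P)$ of $P\in B_m^q$ is the degree of its unique polynomial representative of degree at most $q-1$ in each variable. The weight of $P\in B_m^q$ is $|P|=\mathrm{Card}\{x\in\mathbb{F}_q^m : P(x)\neq 0\}$. The first order generalized Reed-Muller code of length $q^m$ is $R_q(1,m)=\{P\in B_m^q : \deg(P)\leq 1\}$. Its covering radius is $$\rho(1,m)=\max_{f\in B_m^q}\ \min_{c\in R_q(1,m)}|f-c|.$$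
   Formalization: The lower bound is stated only for m ≥ 1 or q = 2: for m = 0 and q ≥ 3 it is false, since ρ(1,0) = 0 while the printed lower bound equals (q-2)/q > 0. The upper bound is kept for all q and all m ≥ 0. *)

(* Defs.v *)
From HB Require Import structures.
From mathcomp Require Import all_boot all_order all_algebra all_field.
From mathcomp Require Import mpoly.

Set Implicit Arguments.
Unset Strict Implicit.
Unset Printing Implicit Defensive.

Import Order.TTheory GRing.Theory.
Local Open Scope ring_scope.

(* The algebra B_m^q of all functions F^m -> F, where q = #|F|; its ring
   operations are the pointwise ones. *)
Notation grm_fun F m := {ffun 'rV[F]_m -> F}.

Section ReducedRepresentative.
Variables (F : finFieldType) (m : nat).
Implicit Types (p : {mpoly F[m]}) (P : grm_fun F m).

Definition mpoly_fun p : grm_fun F m := [ffun x : 'rV[F]_m => p.@[x ord0]].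

Definition reduced p : bool :=
  all (fun e : 'X_{1..m} => [forall i, (e i <= #|F|.-1)%N]) (msupp p).

(* Reduced polynomials are parametrized by their coefficients, indexed by the
   exponents in {0, .., q - 1}^m. *)
Let expo := {ffun 'I_m -> 'I_#|F|}.
Let mnm_of (k : expo) : 'X_{1..m} := [multinom (k i : nat) | i < m].
Let poly_of (c : {ffun expo -> F}) : {mpoly F[m]} :=
  \sum_(k : expo) c k *: 'X_[mnm_of k].

Let poly_of_reduced c : reduced (poly_of c).
Proof.
apply/allP=> e /msupp_sum_le /flattenP[s /mapP[k _ ->]] /msuppZ_le.
rewrite msuppX inE => /eqP->; apply/forallP=> i.
by rewrite mnmE -ltnS prednK ?ltn_ord // (leq_ltn_trans _ (ltn_ord (k i))).
Qed.

Let reduced_poly_of p : reduced p -> exists c, p = poly_of c.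
Proof.
move=> /allP rp; exists [ffun k => p@_(mnm_of k)].
have q_gt0 : (0 < #|F|)%N by apply/card_gt0P; exists 0.
apply/mpolyP=> e; rewrite raddf_sum /=.
under eq_bigr => k _ do rewrite ffunE mcoeffZ mcoeffX.
have [/rp /forallP le_e | e_p] := boolP (e \in msupp p).
  have lt_e i : (e i < #|F|)%N by rewrite -(prednK q_gt0) ltnS le_e.
  pose k0 : expo := [ffun i => Ordinal (lt_e i)].
  have k0E : mnm_of k0 = e by apply/mnmP=> i; rewrite mnmE ffunE.
  rewrite (bigD1 k0) //= k0E eqxx mulr1 big1 ?addr0 // => k neq_k.
  case: eqP => [kE|]; last by rewrite mulr0.
  case/eqP: neq_k; apply/ffunP=> i; apply/val_inj.
  by rewrite ffunE /= -kE mnmE.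
rewrite memN_msupp_eq0 // big1 // => k _.
by case: eqP => [->|]; rewrite ?mulr0 // memN_msupp_eq0 ?mul0r.
Qed.

Let ell (a : F) : {poly F} := 1 - ('X - a%:P) ^+ #|F|.-1.

Let q_gt1 : (1 < #|F|)%N.
Proof. exact: finNzRing_gt1. Qed.

Let size_ell a : (size (ell a) <= #|F|)%N.
Proof.
rewrite (leq_trans (size_polyD _ _)) // size_polyN size_exp_XsubC size_poly1.
by rewrite geq_max prednK ?leqnn ?andbT; rewrite ltnW.
Qed.

Let ellE a x : (ell a).[x] = (x == a)%:R.
Proof.
rewrite !hornerE.
have [->|neq_xa] := eqVneq x a.
  by rewrite subrr expr0n -subn1 subn_eq0 leqNgt q_gt1 subr0.
suff -> : (x - a) ^+ #|F|.-1 = 1 by rewrite subrr.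
apply: (@mulfI _ (x - a)); first by rewrite subr_eq0.
by rewrite -exprS prednK ?expf_card ?mulr1 // ltnW.
Qed.

Let poly_of_surj P : exists c, mpoly_fun (poly_of c) = P.
Proof.
exists [ffun k : expo =>
  \sum_(a : 'rV[F]_m) P a * \prod_i (ell (a ord0 i))`_(k i)].
apply/ffunP=> x; rewrite ffunE raddf_sum /=.
under eq_bigr => k _.
  rewrite mevalZ mevalX ffunE mulr_suml.
  under eq_bigr => a _ do rewrite -mulrA -big_split /=.
  over.
rewrite exchange_big /=.
under eq_bigr => a _.
  rewrite -mulr_sumr.
  under eq_bigr => k _ do under eq_bigr => i _ do rewrite mnmE.
  rewrite -(bigA_distr_bigA (fun i (j : 'I_#|F|) =>
              (ell (a ord0 i))`_j * x ord0 i ^+ j)).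
  under eq_bigr => i _ do rewrite -(horner_coef_wide _ (size_ell _)) ellE.
  over.
rewrite (bigD1 x) //= big1 ?mulr1; last by move=> i _; rewrite eqxx.
rewrite big1 ?addr0 // => a neq_ax.
have [i neq_i] : exists i, x ord0 i != a ord0 i.
  apply/existsP; rewrite -negb_forall; apply: contra neq_ax => /forallP eq_xa.
  by apply/eqP/rowP=> i; rewrite (eqP (eq_xa i)).
by rewrite (bigD1 i) //= (negPf neq_i) mul0r mulr0.
Qed.

Lemma reduced_ex P : exists p, reduced p && (mpoly_fun p == P).
Proof.
by have [c <-] := poly_of_surj P; exists (poly_of c); rewrite poly_of_reduced /=.
Qed.

Lemma reduced_inj p1 p2 :
  reduced p1 -> reduced p2 -> mpoly_fun p1 = mpoly_fun p2 -> p1 = p2.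
Proof.
move=> /reduced_poly_of[c1 ->] /reduced_poly_of[c2 ->] eq_f.
have surjb P : exists c, mpoly_fun (poly_of c) == P.
  by have [c <-] := poly_of_surj P; exists c.
pose g P := xchoose (surjb P).
have gK P : mpoly_fun (poly_of (g P)) = P by apply/eqP/(xchooseP (surjb P)).
have g_onto c : c \in codom g.
  apply: inj_card_onto; first by move=> P1 P2 eqg; rewrite -(gK P1) eqg gK.
  by rewrite !card_ffun card_mx card_ord mul1n card_ord.
have /codomP[P1 c1E] := g_onto c1; have /codomP[P2 c2E] := g_onto c2.
by move: eq_f; rewrite c1E c2E !gK => ->.
Qed.

Definition reduced_repr P : {mpoly F[m]} := xchoose (reduced_ex P).

Lemma reduced_reprP P : reduced (reduced_repr P).
Proof. by case/andP: (xchooseP (reduced_ex P)). Qed.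

Lemma reduced_reprK P : mpoly_fun (reduced_repr P) = P.
Proof. by case/andP: (xchooseP (reduced_ex P)) => _ /eqP. Qed.

Lemma reduced_repr_unique p : reduced p -> reduced_repr (mpoly_fun p) = p.
Proof.
by move=> rp; apply: reduced_inj (reduced_reprK _) => //; apply: reduced_reprP.
Qed.

(* msize is the total degree plus one, so the zero function gets degree 0; it
   lies in every code below, as with the convention deg 0 = -oo. *)
Definition fun_deg P : nat := (msize (reduced_repr P)).-1.

Definition weight P : nat := #|[set x | P x != 0]|.

End ReducedRepresentative.

Section GeneralizedReedMuller.
Variables (F : finFieldType) (r m : nat).

Definition grm_code : {set grm_fun F m} := [set P | (fun_deg P <= r)%N].

(* All weights are at most #|'rV[F]_m| and the code is nonempty, so this default
   value does not affect the minimum. *)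
Definition dist_to_code (f : grm_fun F m) : nat :=
  \big[minn/#|'rV[F]_m|]_(c in grm_code) weight (f - c).

Definition covering_radius : nat := \max_(f : grm_fun F m) dist_to_code f.

End GeneralizedReedMuller.

(* Every function of zero variables is constant. *)
Lemma covering_radius_0vars (F : finFieldType) r : covering_radius F r 0 = 0%N.
Proof.
apply/eqP; rewrite -leqn0; apply/bigmax_leqP=> f _.
have f_in : f \in grm_code F r 0.
  rewrite inE /fun_deg -subn1 leq_subLR msizeE; apply/bigmax_leqP_seq=> e _ _.
  by rewrite mdegE big_ord0.
have := @bigmin_le_cond _ nat _ #|'rV[F]_0| _ _
  (fun c : grm_fun F 0 => weight (f - c)) f_in.
rewrite subrr minEnat leEnat => /leq_trans; apply.
rewrite leqn0 cards_eq0; apply/eqP/setP=> x.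
by rewrite !inE ffunE eqxx.
Qed.

(* Main.v *)
Require Import Defs.
From mathcomp Require Import all_boot all_order all_algebra all_field mpoly.
From mathcomp Require Import reals exp.
From mathcomp Require Import ring lra zify.

(** Write q for the cardinality of F and Q = q ^ m for the number of points.
    A word of the code of order 1 is an affine function x |-> x v + b
    ([grm_code1P]), so the distance from f to the code is Q minus the largest
    number of points where f agrees with an affine function.  Everything is
    about the counts N(v, b) of these agreements.

    Upper bound.  For a fixed slope v the q numbers N(v, b) have sum Q.  Let M
    be the largest of all N(v, b).  The numbers M - N(v, b) are nonnegative,
    hence the sum over b of their squares is at most the square of their sum,
    which is (q M - Q)^2.  Summing over v, the left side becomes known: an
    affine function that agrees with f at two distinct points x and y is
    determined by its slope v, which ranges over the affine hyperplane
    (x - y) v = f(x) - f(y) with Q / q points, and this gives the second moment of N ([sum_agreement_sqr]).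
    What comes out is (q M - Q)^2 >= Q, that is M >= q^(m-1) + q^(m/2-1)
    ([agreement_max_ge]).

    Lower bound.  It suffices to find f with
    N(v, b) <= q^(m-1) + q^(ceil(m/2)-1) for all v and b.  Adding a hyperbolic
    plane x y in two fresh variables preserves this property when m becomes
    m + 2 ([agreement_hyperbolic]): on completing the product, the hyperbola
    (x - c)(y - d) = e has q - 1 points when e is nonzero and q more otherwise,
    so the new count is (q - 1) q^m + q N.  For m = 1 one starts from the
    square, which agrees with an affine function in at most two points.  For
    m = 2 one starts from an anisotropic binary quadratic form, whose agreement
    sets are anisotropic conics with at most q + 1 points
    ([agreement_norm_form]).  Starting from m = 2 is essential in the even
    case: it is the elliptic quadrics that agree rarely with affine functions,
    a sum of hyperbolic planes alone would give too many zeros for q > 2.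
    This is also why m = 0 is allowed only when q = 2. *)

Import GRing.Theory Num.Theory.
Local Open Scope ring_scope.

(** * The code of order one and agreement with affine functions *)

Section AffineFunctions.
Variables (F : finFieldType) (m : nat).
Implicit Types (x : 'rV[F]_m) (v : 'cV[F]_m) (b : F) (f : grm_fun F m).

Definition affine_fun v b : grm_fun F m := [ffun x => (x *m v) 0 0 + b].

Lemma affine_fun0 : affine_fun 0 0 = 0.
Proof. by apply/ffunP=> x; rewrite !ffunE mulmx0 mxE addr0. Qed.

Lemma affine_funD v1 b1 v2 b2 :
  affine_fun v1 b1 + affine_fun v2 b2 = affine_fun (v1 + v2) (b1 + b2).
Proof. by apply/ffunP=> x; rewrite !ffunE mulmxDr [in RHS]mxE addrACA. Qed.

Lemma mpoly_funD (p1 p2 : {mpoly F[m]}) :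
  mpoly_fun (p1 + p2) = mpoly_fun p1 + mpoly_fun p2.
Proof. by apply/ffunP=> x; rewrite !ffunE mevalD. Qed.

(** A monomial of degree at most 1 is constant or a variable, so each term of
    the polynomial is affine. *)
Lemma mpoly_fun_small (p : {mpoly F[m]}) :
  (msize p <= 2)%N -> exists v b, mpoly_fun p = affine_fun v b.
Proof.
move=> sz_p; rewrite [p]mpolyE big_seq.
apply: (big_ind (fun r => exists v b, mpoly_fun r = affine_fun v b)).
- exists 0, 0; rewrite affine_fun0.
  by apply/ffunP=> x; rewrite !ffunE meval0.
- move=> r1 r2 [v1 [b1 e1]] [v2 [b2 e2]]; exists (v1 + v2), (b1 + b2).
  by rewrite mpoly_funD e1 e2 affine_funD.
move=> e /msize_mdeg_lt lt_e; have : (mdeg e < 2)%N by apply: leq_trans lt_e _.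
rewrite ltnS leq_eqVlt ltnS leqn0 mdeg_eq1 mdeg_eq0.
case/orP=> [/existsP[i /eqP eE]|/eqP eE].
- exists (p@_e *: delta_mx i 0), 0; apply/ffunP=> x; rewrite !ffunE addr0.
  by rewrite mevalZ eE mevalXU -scalemxAr mxE -colE mxE.
exists 0, (p@_e); apply/ffunP=> x; rewrite !ffunE mulmx0 mxE add0r.
by rewrite mevalZ eE mpolyX0 meval1 mulr1.
Qed.

Lemma mpoly_fun_linear v b :
  mpoly_fun (\sum_i v i 0 *: 'X_i + b%:MP_[m]) = affine_fun v b.
Proof.
apply/ffunP=> x; rewrite !ffunE mevalD mevalC mxE; congr (_ + _).
rewrite raddf_sum /=; apply: eq_bigr => i _.
by rewrite mevalZ mevalXU mulrC.
Qed.

Lemma msize_linear v b : (msize (\sum_i v i 0 *: 'X_i + b%:MP_[m]) <= 2)%N.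
Proof.
rewrite (leq_trans (mmeasureD_le _ _ _)) // geq_max; apply/andP; split.
  rewrite (leq_trans (mmeasure_sum _ _ _ _)) //; apply/bigmax_leqP=> i _.
  by rewrite (leq_trans (msizeZ_le _ _)) // msizeX mdeg1.
by rewrite mmeasureC; case: (b != 0).
Qed.

(** Since q >= 2, exponents at most 1 are already reduced: a polynomial of
    degree 1 is the reduced representative of its function, whose degree can
    then be read off. *)
Lemma reduced_linear (p : {mpoly F[m]}) : (msize p <= 2)%N -> reduced p.
Proof.
move=> sz_p; apply/allP=> e /msize_mdeg_lt lt_e; apply/forallP=> i.
have q_gt1 : (1 < #|F|)%N := finNzRing_gt1 F.
apply: (@leq_trans 1); last by rewrite -ltnS prednK // ltnW.
rewrite -ltnS; apply: leq_trans sz_p; apply: leq_ltn_trans lt_e.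
by rewrite mdegE (bigD1 i) //= leq_addr.
Qed.

Lemma grm_code1P f :
  reflect (exists v b, f = affine_fun v b) (f \in grm_code F 1 m).
Proof.
rewrite inE /fun_deg; apply: (iffP idP) => [le_f|[v [b ->]]].
  have [|v [b e]] := @mpoly_fun_small (reduced_repr f).
    by move: le_f; case: (msize _) => [|k].
  by exists v, b; rewrite -e reduced_reprK.
rewrite -mpoly_fun_linear reduced_repr_unique; last first.
  exact/reduced_linear/msize_linear.
by have := msize_linear v b; case: (msize _) => [|k].
Qed.

Definition agreement f v b : {set 'rV[F]_m} :=
  [set x | f x == affine_fun v b x].

Lemma weight_sub_affine f v b :
  (weight (f - affine_fun v b)%R + #|agreement f v b|)%N = (#|F| ^ m)%N.
Proof.
rewrite addnC -[X in (_ ^ X)%N]mul1n -card_mx -(cardsC (agreement f v b)).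
congr (_ + _)%N; apply: eq_card => x.
by rewrite !inE !ffunE subr_eq0.
Qed.

Lemma dist_to_code_le f v b :
  (dist_to_code 1 f + #|agreement f v b| <= #|F| ^ m)%N.
Proof.
rewrite -(weight_sub_affine f v b) leq_add2r /dist_to_code.
have cb : affine_fun v b \in grm_code F 1 m by apply/grm_code1P; exists v, b.
have := @Order.TotalTheory.bigmin_le_cond _ nat _ #|'rV[F]_m| _ _
  (fun c : grm_fun F m => weight (f - c)) cb.
by rewrite Order.NatOrder.minEnat Order.NatOrder.leEnat.
Qed.

(** The factor q avoids the fraction q^(m-1) when m = 0. *)
Lemma dist_to_code_ge f (k : nat) :
  (forall v b, #|F| * #|agreement f v b| <= k)%N ->
  (#|F| * #|F| ^ m <= #|F| * dist_to_code 1 f + k)%N.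
Proof.
move=> le_k; rewrite /dist_to_code.
apply: (big_ind (fun d => #|F| * #|F| ^ m <= #|F| * d + k)%N).
(* The default value of the minimum is the number of points. *)
- by rewrite card_mx mul1n leq_addr.
- by move=> d1 d2 h1 h2; rewrite /minn; case: ifP.
move=> c /grm_code1P[v [b ->]].
by rewrite -(weight_sub_affine f v b) mulnDr leq_add2l.
Qed.
End AffineFunctions.
Arguments affine_fun {F m}.
Arguments agreement {F m}.

(** * Counting agreements: first and second moments *)

Lemma card_fibers (T : finType) (W : finType) (h : T -> W) :
  (\sum_c #|[set x | h x == c]| = #|T|)%N.
Proof.
rewrite -sum1_card (partition_big h xpredT) //=.
by apply: eq_bigr => c _; rewrite sum1dep_card.
Qed.

(** The fibers of a surjective morphism are translates of each other. *)
Lemma card_fiber_morph (V W : finZmodType) (h : V -> W) (c : W) :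
  {morph h : x y / x + y} -> (forall d, exists x, h x = d) ->
  (#|W| * #|[set x | h x == c]| = #|V|)%N.
Proof.
move=> hD h_onto; rewrite -(card_fibers _ _ h) -sum_nat_const.
apply: eq_bigr => d _; have [t ht] := h_onto (d - c).
rewrite -(card_imset _ (addrI t)); apply: eq_card => x.
rewrite inE; apply/imsetP/eqP => [[y]|hx].
  by rewrite inE => /eqP hy ->; rewrite hD ht hy subrK.
exists (x - t); last by rewrite addrC subrK.
rewrite inE; apply/eqP/(@addIr _ (h t)).
by rewrite -hD subrK hx ht addrC subrK.
Qed.

Lemma sum_sqr_le (I : finType) (d : I -> nat) :
  (\sum_i d i ^ 2 <= (\sum_i d i) ^ 2)%N.
Proof.
apply: (big_ind2 (fun s t => s <= t ^ 2)%N) => // s1 t1 s2 t2 h1 h2.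
by rewrite sqrnD -addnA leq_add // (leq_trans h2) ?leq_addr.
Qed.

Section Counting.
Variables (F : finFieldType) (m : nat).
Implicit Types (x y : 'rV[F]_m) (v : 'cV[F]_m) (b : F) (f : grm_fun F m).

Lemma card_dual_hyperplane x c :
  x != 0 -> (#|F| * #|[set v : 'cV[F]_m | (x *m v) 0%R 0%R == c]| = #|F| ^ m)%N.
Proof.
move=> x_neq0; rewrite -[m in RHS]muln1 -card_mx.
apply: (card_fiber_morph _ _ (fun v => (x *m v) 0 0)) => [v w|d].
  by rewrite mulmxDr [LHS]mxE.
have [i xi] : exists i, x 0 i != 0.
  apply/existsP; rewrite -negb_forall; apply: contra x_neq0 => /forallP x0.
  by apply/eqP/rowP=> i; rewrite mxE (eqP (x0 i)).
exists ((d / x 0 i) *: delta_mx i 0).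
by rewrite -scalemxAr -colE !mxE mulfVK.
Qed.

Lemma dotB x y v : ((x - y) *m v) 0 0 = (x *m v) 0 0 - (y *m v) 0 0.
Proof. by rewrite mulmxBl mxE [X in _ + X = _]mxE. Qed.

(** For each point and slope there is exactly one intercept. *)
Lemma sum_agreement f v : (\sum_b #|agreement f v b| = #|F| ^ m)%N.
Proof.
rewrite -[in RHS](mul1n m) -card_mx -(card_fibers _ _ (fun x => f x - (x *m v) 0 0)).
apply: eq_bigr => b _; apply: eq_card => x.
by rewrite !inE ffunE subr_eq addrC.
Qed.

(** The intercept is determined by x, so at most one b contributes; it does when
    the slope v is compatible with both points. *)
Lemma sum_agreement_pair f v x y :
  (\sum_b (x \in agreement f v b) * (y \in agreement f v b) =
   ((((x - y) *m v) 0 0 == f x - f y)%R : nat))%N.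
Proof.
rewrite (bigD1 (f x - (x *m v) 0 0)) //= big1 ?addn0 => [|b neq_b].
  rewrite !inE !ffunE dotB addrC subrK eqxx mul1n.
  congr (nat_of_bool _); apply/eqP/eqP => e; first by rewrite e; ring.
  by rewrite -[LHS](subKr (f x)) -e; ring.
rewrite !inE !ffunE -[_ == _](inj_eq (addrI (- (x *m v) 0 0))).
by rewrite addKr addrC eq_sym (negPf neq_b).
Qed.

(** The second moment of the agreement counts counts triples of two points and
    a slope compatible with f at both.  If the points are equal every slope is;
    otherwise the slopes form a hyperplane of the dual space.  The term added on
    the left compensates for a truncated subtraction. *)
Lemma sum_agreement_sqr f :
  (#|F| * (\sum_v \sum_b #|agreement f v b| ^ 2) + #|F| ^ m * #|F| ^ m =
   #|F| ^ m * (#|F| * #|F| ^ m + #|F| ^ m * #|F| ^ m))%N.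
Proof.
have -> : (\sum_v \sum_b #|agreement f v b| ^ 2 =
    \sum_x \sum_y #|[set v : 'cV[F]_m | (((x - y) *m v) 0 0 == f x - f y)%R]|)%N.
  transitivity (\sum_v \sum_b \sum_x \sum_y
      (x \in agreement f v b) * (y \in agreement f v b))%N.
    apply: eq_bigr => v _; apply: eq_bigr => b _.
    by rewrite -mulnn -!sum1_card !big_mkcond big_distrlr.
  under eq_bigr => v _ do rewrite exchange_big /=.
  rewrite exchange_big; apply: eq_bigr => x _.
  under eq_bigr => v _ do rewrite exchange_big /=.
  rewrite exchange_big; apply: eq_bigr => y _.
  rewrite -sum1dep_card [RHS]big_mkcond; apply: eq_bigr => v _.
  rewrite -[RHS]/((((x - y) *m v) 0 0 == f x - f y) : nat).
  by rewrite -sum_agreement_pair.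
have cardT : #|'rV[F]_m| = (#|F| ^ m)%N by rewrite card_mx mul1n.
set Q := (#|F| ^ m)%N in cardT *.
transitivity (\sum_(x : 'rV[F]_m) (#|F| * Q + Q * Q))%N; last first.
  by rewrite sum_nat_const cardT.
have QQ : (Q * Q = \sum_(x : 'rV[F]_m) Q)%N by rewrite sum_nat_const cardT.
rewrite [X in (_ + X = _)%N]QQ big_distrr -big_split /=.
apply: eq_bigr => x _; rewrite (bigD1 x) //= mulnDr -addnA; congr (_ + _)%N.
  rewrite /Q -[in RHS](muln1 m) -card_mx; congr (_ * _)%N; apply: eq_card => v.
  by rewrite !inE !subrr mul0mx mxE eqxx.
rewrite QQ [RHS](bigD1 x) //= addnC big_distrr /=.
congr (_ + _)%N; apply: eq_bigr => y neq_y.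
by rewrite card_dual_hyperplane // subr_eq0 eq_sym.
Qed.

(** Deficiencies M - N(v, b) are nonnegative, so for each slope the sum of their
    squares is at most the square of their sum; summed over the slopes, this
    compares the second moment with (q M - Q)^2.  The first conclusion makes
    the subtraction in the second one a true one. *)
Lemma agreement_max_ge f (M : nat) :
  (forall v b, #|agreement f v b| <= M)%N ->
  (#|F| ^ m <= #|F| * M)%N /\ (#|F| ^ m <= (#|F| * M - #|F| ^ m) ^ 2)%N.
Proof.
move=> le_M; set q := #|F|; set Q := (q ^ m)%N.
have sum_N v : (\sum_b #|agreement f v b| = Q)%N := sum_agreement f v.
pose d v b := (M - #|agreement f v b|)%N.
have dE v b : (d v b + #|agreement f v b| = M)%N by rewrite subnK.
have sum_d v : (\sum_b d v b + Q = q * M)%N.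
  rewrite -sum_nat_const -(sum_N v) -big_split.
  by apply: eq_bigr => b _ /=.
split; first by rewrite -(sum_d 0) leq_addl.
set D := (q * M - Q)%N.
have sum_d2 v : (\sum_b d v b ^ 2 <= D ^ 2)%N.
  by rewrite /D -(sum_d v) addnK sum_sqr_le.
(* (M - N)^2 + 2 M N = M^2 + N^2, summed over the intercepts. *)
have sum_d2E v : (\sum_b d v b ^ 2 + 2 * M * Q =
    q * M ^ 2 + \sum_b #|agreement f v b| ^ 2)%N.
  rewrite -sum_nat_const -(sum_N v) big_distrr -!big_split /=.
  apply: eq_bigr => b _; move: (dE v b); move: (d v b) #|_| => s t.
  by move <-; ring.
have cardT : #|'cV[F]_m| = Q by rewrite card_mx muln1.
have le_D : (\sum_v \sum_b d v b ^ 2 <= Q * D ^ 2)%N.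
  by rewrite -cardT -sum_nat_const leq_sum.
have sum_E : (\sum_v \sum_b d v b ^ 2 + Q * (2 * M * Q) =
    Q * (q * M ^ 2) + \sum_v \sum_b #|agreement f v b| ^ 2)%N.
  transitivity (\sum_v (\sum_b d v b ^ 2 + 2 * M * Q))%N.
    by rewrite big_split sum_nat_const cardT.
  by rewrite (eq_bigr _ (fun v _ => sum_d2E v)) big_split sum_nat_const cardT.
have S2 := sum_agreement_sqr f; rewrite -/q -/Q in S2.
have q_gt1 : (1 < q)%N := finNzRing_gt1 F.
have Q_gt0 : (0 < Q)%N by rewrite expn_gt0 ltnW.
have DE : (D + Q = q * M)%N by rewrite subnK // -(sum_d 0) leq_addl.
(* The combined inequality carries the common factor (q - 1) Q. *)
suff : (q.-1 * Q <= q.-1 * D ^ 2)%N by rewrite leq_pmul2l // -ltnS prednK // ltnW.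
rewrite -(leq_pmul2l Q_gt0).
move: sum_E S2 le_D DE; move: (\sum_v _)%N (\sum_v _)%N => s2 s1.
clearbody D.
move=> sum_E S2 le_D DE.
have sum_qE : (q * s1 + 2 * Q * Q * (D + Q) = Q * (D + Q) ^ 2 + q * s2)%N.
  rewrite DE; transitivity (q * (s1 + Q * (2 * M * Q)))%N; first by ring.
  by rewrite sum_E; ring.
have le_qD : (q * s1 <= q * (Q * D ^ 2))%N by rewrite leq_mul2l le_D orbT.
clear -q_gt1 sum_qE le_qD S2; clearbody Q; clearbody q.
case: q q_gt1 sum_qE le_qD S2 => // p _; rewrite succnK.
by lia.
Qed.
End Counting.

(** * Bounds on the covering radius through agreements *)

(** M is the maximal number of agreements of a function that attains the covering
    radius. *)
Lemma covering_radius1_le (F : finFieldType) (m : nat) :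
  exists M, [/\ covering_radius F 1 m + M <= #|F| ^ m,
    #|F| ^ m <= #|F| * M & #|F| ^ m <= (#|F| * M - #|F| ^ m) ^ 2]%N.
Proof.
have [|f rhoE] := @eq_bigmax (grm_fun F m) (@dist_to_code F 1 m).
  by apply/card_gt0P; exists 0.
have [|[v b] ME] := @eq_bigmax ('cV[F]_m * F)%type
    (fun vb => #|agreement f vb.1 vb.2|).
  by apply/card_gt0P; exists (0, 0).
have le_M w c : (#|agreement f w c| <= #|agreement f v b|)%N.
  rewrite -[leqRHS]ME.
  exact: (leq_bigmax (w, c) : (#|agreement f (w, c).1 (w, c).2| <= _)%N).
have [le_qM ge_D] := agreement_max_ge _ _ _ _ le_M.
exists #|agreement f v b|.
by split=> //; rewrite /covering_radius rhoE dist_to_code_le.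
Qed.

Lemma covering_radius1_ge (F : finFieldType) (m : nat) f (k : nat) :
  (forall v b, #|F| * #|@agreement F m f v b| <= k)%N ->
  (#|F| * #|F| ^ m <= #|F| * covering_radius F 1 m + k)%N.
Proof.
move=> /dist_to_code_ge /leq_trans; apply.
by rewrite leq_add2r leq_mul2l orbC leq_bigmax.
Qed.

(** * Functions that agree rarely with every affine function *)

Section LowAgreement.
Variable F : finFieldType.

Lemma sum_rV_cons n (G : 'rV[F]_(1 + n) -> nat) :
  (\sum_x G x = \sum_(w : 'rV[F]_n) \sum_(s : F) G (row_mx s%:M w))%N.
Proof.
rewrite (partition_big (fun x => rsubmx x) xpredT) //=.
apply: eq_bigr => w _.
rewrite (reindex_onto (fun s : F => row_mx s%:M w) (fun x => lsubmx x 0 0)).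
  by apply: eq_bigl => s; rewrite row_mxKr row_mxKl mxE !eqxx.
by move=> x /= /eqP <-; rewrite -mx11_scalar hsubmxK.
Qed.

Lemma card_set_sum (T : finType) (P : pred T) : #|[set x | P x]| = (\sum_x P x)%N.
Proof. by rewrite -sum1dep_card big_mkcond. Qed.

Lemma dot_row_mx n (s : F) (w : 'rV[F]_n) (v : 'cV[F]_(1 + n)) :
  (row_mx s%:M w *m v) 0 0 = s * usubmx v 0 0 + (w *m dsubmx v) 0 0.
Proof.
by rewrite -[v in LHS]vsubmxK mul_row_col mul_scalar_mx [LHS]mxE [X in X + _]mxE.
Qed.

(** For s <> c there is one t; for s = c every t or none. *)
Lemma card_hyperbola (c d e : F) :
  (\sum_s #|[set t | ((s - c) * (t - d))%R == e]| =
   #|F|.-1 + #|F| * (e == 0%R))%N.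
Proof.
rewrite (bigD1 c) //= addnC; congr (_ + _)%N.
  have -> : #|F|.-1 = #|[pred s | s != c]|.
    by rewrite -(cardC1 c); apply: eq_card.
  rewrite -sum1_card; apply: eq_bigr => s neq_s.
  rewrite -(cards1 (d + e / (s - c))); apply: eq_card => t.
  have sc : s - c != 0 by rewrite subr_eq0.
  by rewrite !inE mulrC (can2_eq (mulfK sc) (mulfVK sc)) subr_eq addrC.
rewrite subrr; have [->|neq_e] := eqVneq e 0.
  by rewrite muln1; apply: eq_card => t; rewrite !inE mul0r eqxx.
rewrite muln0; apply: eq_card0 => t.
by rewrite !inE mul0r eq_sym (negPf neq_e).
Qed.

Definition hyperbolic_plus n (g : grm_fun F n) : grm_fun F n.+2 :=
  [ffun x : 'rV[F]_(1 + (1 + n)) =>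
     lsubmx x 0 0 * lsubmx (rsubmx x) 0 0 + g (rsubmx (rsubmx x))].

(** With the last n coordinates w fixed, s t + g w = s c0 + t c1 + w v2 + b
    completes to (s - c1)(t - c0) = w v2 + b + c0 c1 - g w.  This hyperbola is
    degenerate, and has q extra points, exactly where g agrees with the affine
    function of slope v2 and intercept b + c0 c1. *)
Lemma agreement_hyperbolic n (g : grm_fun F n) (v : 'cV[F]_n.+2) b :
  exists v' b', #|agreement (hyperbolic_plus n g) v b| =
    (#|F|.-1 * #|F| ^ n + #|F| * #|agreement g v' b'|)%N.
Proof.
pose c0 := usubmx (v : 'cV_(1 + (1 + n))) 0 0.
pose v1 := dsubmx (v : 'cV_(1 + (1 + n))).
pose c1 := usubmx v1 0 0; pose v2 := dsubmx v1.
exists v2, (b + c0 * c1).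
rewrite card_set_sum (@sum_rV_cons n.+1) (@sum_rV_cons n).
have -> : (#|F|.-1 * #|F| ^ n = \sum_(w : 'rV[F]_n) #|F|.-1)%N.
  by rewrite sum_nat_const card_mx mul1n mulnC.
rewrite card_set_sum big_distrr -big_split; apply: eq_bigr => w _ /=.
pose e := affine_fun v2 (b + c0 * c1) w - g w.
rewrite [g w == _]eq_sym -subr_eq0 -[_ - g w]/e -(card_hyperbola c0 c1).
apply: eq_bigr => t _; rewrite card_set_sum; apply: eq_bigr => s _.
rewrite !ffunE !(row_mxKl, row_mxKr, dot_row_mx) -/v1 -/v2 -/c0 -/c1.
rewrite /e ffunE !mxE eqxx !mulr1n.
congr nat_of_bool; rewrite -subr_eq0 -[RHS]subr_eq0.
by congr (_ == 0); ring.
Qed.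

(** The map s |-> - (s^2 + s) takes the value 0 at both 0 and -1, hence is not
    injective and, F being finite, not surjective; any missed value works.
    This treats all characteristics alike. *)
Lemma exists_rootless_quadratic : exists d : F, forall s, s ^+ 2 + s + d != 0.
Proof.
suff /existsP[d /forallP] : [exists d : F, [forall s, s ^+ 2 + s + d != 0]].
  by exists d.
apply: contraT => /existsPn no_d.
have /fin_all_exists[g gP] d : exists s : F, - (s ^+ 2 + s) = d.
  have /forallPn[s /negPn] := no_d d.
  by rewrite addrC addr_eq0 => /eqP ->; exists s.
have gK : cancel g (fun s : F => - (s ^+ 2 + s)) by exact: gP.
have /can_inj inj := canF_sym gK.
have /eqP : 0 = -1 :> F by apply: inj; ring.
by rewrite eq_sym oppr_eq0 oner_eq0.
Qed.

(** When X^2 + X + d has no root, this is the norm form of the quadratic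
    extension that it defines. *)
Definition norm_form (d : F) : grm_fun F 2 :=
  [ffun x : 'rV[F]_2 => x 0 0 ^+ 2 + x 0 0 * x 0 1 + d * x 0 1 ^+ 2].

Lemma norm_form_eq0 d x :
  (forall s, s ^+ 2 + s + d != 0) -> (norm_form d x == 0) = (x == 0).
Proof.
move=> d_rootless; apply/eqP/eqP => [|->]; last by rewrite ffunE !mxE; ring.
rewrite ffunE => x_eq.
have x1 : x 0 1 = 0.
  apply: contraTeq isT => x1; have := d_rootless (x 0 0 / x 0 1).
  suff -> : (x 0 0 / x 0 1) ^+ 2 + x 0 0 / x 0 1 + d = 0 by rewrite eqxx.
  apply: (mulIf (expf_neq0 2 x1)); rewrite mul0r -[RHS]x_eq; field.
  exact: x1.
have x0 : x 0 0 = 0.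
  by apply/eqP; rewrite -sqrf_eq0 -x_eq x1; apply/eqP; ring.
apply/rowP=> -[[|[|//]] lt_i]; rewrite mxE; [rewrite -[RHS]x0|rewrite -[RHS]x1].
  by congr (x _ _); apply: val_inj.
by congr (x _ _); apply: val_inj.
Qed.

Lemma dot2 (x : 'rV[F]_2) (v : 'cV[F]_2) :
  (x *m v) 0 0 = x 0 0 * v 0 0 + x 0 1 * v 1 0.
Proof.
rewrite mxE big_ord_recl big_ord1.
by rewrite (_ : lift _ _ = 1) //; apply: val_inj.
Qed.

(** An agreement set A is a conic.  Seen from one of its points p, its equation
    reads N(u) = L(u) with u = x - p, N the anisotropic form and L linear.  The
    inversion u |-> u / N(u) is an involution, and it sends the solutions u <> 0
    to the line L = 1, which has at most q points. *)
Lemma agreement_norm_form d v b : (forall s, s ^+ 2 + s + d != 0) ->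
  (#|agreement (norm_form d) v b| <= #|F|.+1)%N.
Proof.
move=> d_rootless; set A := agreement _ _ _.
have [->|[p pA]] := set_0Vmem A; first by rewrite cards0.
rewrite (cardsD1 p) pA ltnS.
(* L is the affine function's slope minus the polar form of N at p. *)
pose v' : 'cV[F]_2 := \col_i
  if i == 0 then v 0 0 - 2 * p 0 0 - p 0 1 else v 1 0 - p 0 0 - 2 * d * p 0 1.
have secant x : x \in A -> norm_form d (x - p) = ((x - p) *m v') 0 0.
  rewrite inE in pA; rewrite inE => xA.
  apply/eqP; rewrite -subr_eq0; apply/eqP.
  transitivity ((norm_form d x - affine_fun v b x) -
                (norm_form d p - affine_fun v b p)).
    by rewrite !ffunE !dot2 !mxE /=; ring.
  by rewrite (eqP xA) (eqP pA) !subrr.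
pose inv (u : 'rV[F]_2) := (norm_form d u)^-1 *: u.
have normZ c u : norm_form d (c *: u) = c ^+ 2 * norm_form d u.
  by rewrite !ffunE !mxE; ring.
have invK : involutive inv.
  move=> u; rewrite /inv normZ; have [->|u0] := eqVneq u 0; first by rewrite !scaler0.
  rewrite scalerA; move: u0; rewrite -(norm_form_eq0 _ _ d_rootless) => u0.
  rewrite -[RHS]scale1r; congr (_ *: _); move: u0.
  by move: (norm_form d u) => N N0; field; rewrite N0 oner_neq0.
have inj : injective (fun x => inv (x - p)).
  exact: (inj_comp (inv_inj invK) (addIr (- p))).
rewrite -(card_imset _ inj).
set L := [set z : 'rV[F]_2 | (z *m v') 0 0 == 1].
have sub_L : [set inv (x - p) | x in A :\ p] \subset L.
  apply/subsetP=> _ /imsetP[x /setD1P[neq_x xA] ->].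
  rewrite inE /inv -scalemxAl mxE -secant // mulVf // norm_form_eq0 //.
  by rewrite subr_eq0.
apply: leq_trans (subset_leq_card sub_L) _.
(* L = 1 is empty when L = 0, and a fiber of a surjection otherwise. *)
have [->|[z1 z1L]] := set_0Vmem L; first by rewrite cards0.
have : (#|F| * #|L| = #|F| ^ 2)%N.
  have <- : #|'rV[F]_2| = (#|F| ^ 2)%N by rewrite card_mx.
  apply: (card_fiber_morph _ _ (fun z => (z *m v') 0 0)) => [y z|c].
    by rewrite mulmxDl [LHS]mxE.
  rewrite inE in z1L; exists (c *: z1).
  by rewrite -scalemxAl mxE (eqP z1L) mulr1.
rewrite -mulnn => /eqP; rewrite eqn_pmul2l; first by move/eqP ->.
exact: ltnW (finNzRing_gt1 F).
Qed.

Definition square_fun : grm_fun F 1 := [ffun x : 'rV[F]_1 => x 0 0 ^+ 2].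

(** If p is one agreement, the sum of the two roots gives the only other
    candidate. *)
Lemma agreement_square v b : (#|agreement square_fun v b| <= 2)%N.
Proof.
set A := agreement _ _ _.
have [->|[p pA]] := set_0Vmem A; first by rewrite cards0.
suff sub_A : A \subset [set p; v 0 0 *: 1%:M - p].
  by apply: leq_trans (subset_leq_card sub_A) _; rewrite cards2; case: eqP.
apply/subsetP=> x; move: pA; rewrite !inE !ffunE !mxE !big_ord1.
move=> /eqP pA /eqP xA.
have : (x 0 0 - p 0 0) * (x 0 0 - (v 0 0 - p 0 0)) = 0.
  transitivity ((x 0 0 ^+ 2 - (x 0 0 * v 0 0 + b)) -
                (p 0 0 ^+ 2 - (p 0 0 * v 0 0 + b))); first by ring.
  by rewrite xA pA !subrr.
move/eqP; rewrite mulf_eq0 !subr_eq0 => /orP[] /eqP x0; apply/orP; [left|right].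
  by apply/eqP/rowP=> i; rewrite ord1.
by apply/eqP/rowP=> i; rewrite ord1 !mxE eqxx mulr1.
Qed.

Lemma exists_low_agreement m : (0 < m)%N \/ #|F| = 2%N ->
  exists f : grm_fun F m, forall v b,
    (#|F| * #|agreement f v b| <= #|F| ^ m + #|F| ^ uphalf m)%N.
Proof.
have q_gt0 : (0 < #|F|)%N := ltnW (finNzRing_gt1 F).
elim/ltn_ind: m => -[|[|[|m]]] IH hm.
(* m = 0 and q = 2: the single point counts at most once. *)
- exists 0 => v b; case: hm => // q2; rewrite q2 -[leqRHS]/(2 * 1)%N leq_mul2l /=.
  by rewrite (leq_trans (max_card _)) // card_mx mul1n.
- exists square_fun => v b; rewrite -[uphalf 1]/1%N !expn1 addnn -muln2 leq_mul2l.
  by rewrite agreement_square orbT.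
- have [d d_rootless] := exists_rootless_quadratic.
  exists (norm_form d) => v b; rewrite -[X in (_ <= X)%N]/(#|F| ^ 2 + #|F| ^ 1)%N.
  by rewrite expn1 -mulnn -mulnSr leq_mul2l agreement_norm_form ?orbT.
have [//||f fP] := IH m.+1; first by left.
exists (hyperbolic_plus _ f) => v b.
have [v' [b' ->]] := agreement_hyperbolic _ f v b.
have := fP v' b'; rewrite (expnS _ m.+2) (expnS _ (m.+1)).
rewrite (_ : uphalf m.+3 = (uphalf m.+1).+1) // (expnS _ (uphalf _)).
move: (#|F|) q_gt0 => q; case: q => // q _.
move: (_ ^ uphalf _)%N (_ ^ m.+1)%N #|_| => U Q N /=.
move=> le_N; rewrite [X in (_ <= X)%N](_ : _ = q.+1 * (q * Q + (Q + U)))%N; last by ring.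
by rewrite leq_mul2l leq_add2l le_N.
Qed.
End LowAgreement.

(** * The theorem *)

Lemma ceil_half (R : realType) (m : nat) :
  Num.ceil (m%:R / 2 : R) = (uphalf m)%:Z.
Proof.
apply: ceil_def; rewrite rmorphB /= -!pmulrn.
have -> : m%:R = (uphalf m)%:R * 2 - (odd m)%:R :> R.
  rewrite -{1}(odd_double_half m) uphalf_half -muln2 !natrD natrM.
  by case: (odd m) => /=; ring.
have o_ge0 : 0 <= (odd m)%:R :> R by exact: ler0n.
have o_le1 : (odd m)%:R <= 1 :> R by rewrite lern1 leq_b1.
by apply/andP; split; lra.
Qed.

Theorem theorem3 (R : realType) (F : finFieldType) (m : nat) :
  let q : R := #|F|%:R in
  let rho : R := (covering_radius F 1 m)%:R in
  ((0 < m)%N \/ #|F| = 2%N ->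
     (q - 1) * q ^ (m%:Z - 1) - q ^ (Num.ceil (m%:R / 2 : R) - 1) <= rho) /\
  rho <= (q - 1) * q ^ (m%:Z - 1) - q `^ (m%:R / 2 - 1).
Proof.
move=> q rho.
have q_gt0 : 0 < q by rewrite ltr0n; apply: ltnW (finNzRing_gt1 F).
have q_neq0 : q != 0 by apply: lt0r_neq0.
have expB1 (k : nat) : q ^ (k%:Z - 1) = q ^+ k / q.
  by rewrite expfzDr // exprN1.
rewrite ceil_half !expB1; split=> [hm|].
  have [f f_low] := exists_low_agreement F m hm.
  have := covering_radius1_ge _ _ f _ f_low.
  rewrite -(ler_nat R) !(natrD, natrM, natrX) -/q -/rho => le_rho.
  rewrite -(ler_pM2l q_gt0).
  have -> : q * ((q - 1) * (q ^+ m / q) - q ^+ uphalf m / q) =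
    (q - 1) * q ^+ m - q ^+ uphalf m by field.
  lra.
have [M [le_rho le_Q le_sqr]] := covering_radius1_le F m.
move: le_rho le_sqr; rewrite -!(ler_nat R) !(natrD, natrX) natrB // natrM.
rewrite natrX -/q -/rho => le_rho le_sqr.
have -> : q `^ (m%:R / 2 - 1) = q `^ (m%:R / 2) / q.
  by rewrite powRB ?q_neq0 ?implybT // powRr1 // ltW.
set h := q `^ _.
have h_sqr : h ^+ 2 = q ^+ m.
  by rewrite expr2 -powRD ?q_neq0 ?implybT // -splitr powR_mulrn // ltW.
have le_h : h <= q * M%:R - q ^+ m.
  rewrite -(@ler_pXn2r _ 2) ?nnegrE ?powR_ge0 ?h_sqr //.
  by rewrite subr_ge0 -natrX -natrM ler_nat.
rewrite -(ler_pM2l q_gt0).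
have -> : q * ((q - 1) * (q ^+ m / q) - h / q) = (q - 1) * q ^+ m - h by field.
have : q * (rho + M%:R) <= q * q ^+ m by rewrite ler_pM2l.
lra.
Qed.
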